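(* Let $e\in\mathbb{N}$ and let $(a,b)\in\mathbb{N}^2$ be such that $1\le a\le q-1$ and $0\le b-ea\le q-1$. Let $d_e(a,b)^\perp$ denote the minimum distance of the dual code $C_e(a,b)^\perp$. Then $$d_e(a,b)^\perp=\min\{a,\,b-ea\}+2 .$$
   Context: $q$ is a prime power, $\mathbb{F}_q=\{\alpha_1,\dots,\alpha_q\}$ is the field with $q$ elements, $\mathbb{N}=\{0,1,2,\dots\}$, and $0^0:=1$. The minimum distance of a linear code is the minimal Hamming weight of its nonzero words; duals are taken with respect to the standard (Euclidean) bilinear form. The code $C_e(a,b)$: choose representatives of $\mathbb{P}^1(\mathbb{F}_q)$ in the order $(0,1),(1,\alpha_1),\dots,(1,\alpha_q)$. Let $L_*(aS_e+bF_e)$ be the $\mathbb{F}_q$-span of the monomials $X_1^{d_1}X_2^{d_2}T_1^{c_1}T_2^{c_2}$ with nonnegative exponents satisfying $d_1+d_2=a$ and $c_1+c_2-ed_1=b-ea$. The code $C_e(a,b)\subset\mathbb{F}_q^{(q+1)^2}$ is the set of vectors $\big(f(x_1,x_2,t_1,t_2)\big)$, $f\in L_*(aS_e+bF_e)$, where $(x_1,x_2)$ and $(t_1,t_2)$ run independently over the chosen representatives of $\mathbb{P}^1(\mathbb{F}_q)$. (This is the evaluation code on the $(q+1)^2$ $\mathbb{F}_q$-points of the Hirzebruch surface $\mathcal{H}_e$ attached to the divisor $aS_e+bF_e$.) *)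

(* Defs.v *)
From HB Require Import structures.
From mathcomp Require Import all_boot all_order all_algebra.
From mathcomp Require Import mpoly.

Set Implicit Arguments.
Unset Strict Implicit.
Unset Printing Implicit Defensive.

Import GRing.Theory.
Local Open Scope ring_scope.

(* Words have entries indexed by an arbitrary finite type I; a code is given by
   its membership predicate. *)
Section LinearCodes.
Variables (F : finFieldType) (I : finType).

Definition word := {ffun I -> F}.

Definition hamming_weight (w : word) : nat := #|[set i | w i != 0]|.

Definition dual_code (C : word -> Prop) (w : word) : Prop :=
  forall c : word, C c -> \sum_i c i * w i = 0.

(* A relation rather than a function: the zero code has no minimum distance. *)
Definition is_min_distance (C : word -> Prop) (d : nat) : Prop :=
  (exists w, [/\ C w, w != 0 & hamming_weight w = d]) /\
  (forall w, C w -> w != 0 -> (d <= hamming_weight w)%N).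

End LinearCodes.

(* [None] stands for the point (0 : 1) and [Some alpha] for (1 : alpha). *)
Definition proj_line (F : finFieldType) : finType := option F.

Definition repr1 (F : finFieldType) (P : proj_line F) : F :=
  if P is Some _ then 1 else 0.

Definition repr2 (F : finFieldType) (P : proj_line F) : F :=
  if P is Some alpha then alpha else 1.

Definition iX1 : 'I_4 := @Ordinal 4 0 isT.
Definition iX2 : 'I_4 := @Ordinal 4 1 isT.
Definition iT1 : 'I_4 := @Ordinal 4 2 isT.
Definition iT2 : 'I_4 := @Ordinal 4 3 isT.

Section Hirzebruch.
Variables (F : finFieldType) (e a b : nat).

Definition hirzebruch_monomial (m : 'X_{1..4}) : Prop :=
  (m iX1 + m iX2 = a)%N /\
  (m iT1 + m iT2)%:Z - (e * m iX1)%:Z = b%:Z - (e * a)%:Z.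

Definition hirzebruch_space (f : {mpoly F[4]}) : Prop :=
  exists (s : seq 'X_{1..4}) (c : 'X_{1..4} -> F),
    (forall m, m \in s -> hirzebruch_monomial m) /\
    f = \sum_(m <- s) c m *: 'X_[m].

Definition hirzebruch_point : finType := (proj_line F * proj_line F)%type.

Definition coordinates (P : hirzebruch_point) : 4.-tuple F :=
  [tuple repr1 P.1; repr2 P.1; repr1 P.2; repr2 P.2].

Definition hirzebruch_eval (f : {mpoly F[4]}) : word F hirzebruch_point :=
  [ffun P => f.@[tnth (coordinates P)]].

Definition hirzebruch_code (w : word F hirzebruch_point) : Prop :=
  exists2 f, hirzebruch_space f & w = hirzebruch_eval f.

End Hirzebruch.

(* Main.v *)
(* The minimum distance of the dual is the least number of linearly dependent
   evaluation functionals. Put delta = b - e a. On x = (0 : 1) the functions of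
   the space restrict to binary forms of degree delta, on t = (0 : 1) to binary
   forms of degree a, so delta + 2 points of the former curve, or a + 2 points
   of the latter, carry a dependency. Conversely, min(a, delta) points Q can be
   separated from a further point P = (x, t) by a product of one linear form in
   T and one factor c X2 - d X1 N(T)^e, with N(t) <> 0, for each Q: the first
   kills Q if Q lies over another t, the second if Q lies over the same t. *)
Require Import Defs.
From mathcomp Require Import all_boot all_order all_algebra.
From mathcomp Require Import mpoly.
From mathcomp Require Import zify ring.

Set Implicit Arguments.
Unset Strict Implicit.
Unset Printing Implicit Defensive.

Import GRing.Theory.
Local Open Scope ring_scope.

Section HirzebruchSpace.
Variables (F : finFieldType) (e : nat).
Implicit Types (a b : nat) (f g : {mpoly F[4]}) (P Q : hirzebruch_point F).

(** * The bigraded spaces of polynomials and their products *)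

Lemma hirzebruch_monomialE a b m : hirzebruch_monomial e a b m <->
  (m iX1 + m iX2 = a /\ m iT1 + m iT2 + e * a = b + e * m iX1)%N.
Proof. by rewrite /hirzebruch_monomial; split=> -[? ?]; split => //; lia. Qed.

(** Distinct monomials are independent, so the support decides membership; closure under sums and
    products then reduces to exponents. *)
Lemma hirzebruch_spaceP a b f : hirzebruch_space e a b f <->
  (forall m, m \in msupp f -> hirzebruch_monomial e a b m).
Proof.
split=> [[s [c [hs ->]]] m /msupp_sum_le /flattenP[/= _ /mapP[n + ->]]|hf].
  by rewrite filter_predT => /hs hn /msuppZ_le; rewrite msuppX inE => /eqP->.
by exists (msupp f), (fun m => f@_m); split=> //; exact: mpolyE.
Qed.

Lemma hirzebruch_spaceX a b m :
  hirzebruch_monomial e a b m -> hirzebruch_space e a b 'X_[F, m].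
Proof. by move=> hm; apply/hirzebruch_spaceP=> n; rewrite msuppX inE => /eqP->. Qed.

Lemma hirzebruch_spaceD a b f g :
  hirzebruch_space e a b f -> hirzebruch_space e a b g ->
  hirzebruch_space e a b (f + g).
Proof.
move=> /hirzebruch_spaceP hf /hirzebruch_spaceP hg; apply/hirzebruch_spaceP=> m.
by move=> /msuppD_le; rewrite mem_cat => /orP[/hf|/hg].
Qed.

Lemma hirzebruch_spaceZ a b k f :
  hirzebruch_space e a b f -> hirzebruch_space e a b (k *: f).
Proof.
by move=> /hirzebruch_spaceP hf; apply/hirzebruch_spaceP=> m /msuppZ_le /hf.
Qed.

Lemma hirzebruch_spaceM a b a' b' f g :
  hirzebruch_space e a b f -> hirzebruch_space e a' b' g ->
  hirzebruch_space e (a + a') (b + b') (f * g).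
Proof.
move=> /hirzebruch_spaceP hf /hirzebruch_spaceP hg; apply/hirzebruch_spaceP=> m.
move=> /msuppM_le /allpairsP[[m1 m2] /= [/hf + /hg + ->]].
move=> /hirzebruch_monomialE[? ?] /hirzebruch_monomialE[? ?].
by apply/hirzebruch_monomialE; rewrite !mnmDE; split; nia.
Qed.

Lemma hirzebruch_space1 : hirzebruch_space e 0 0 (1 : {mpoly F[4]}).
Proof.
rewrite -mpolyX0; apply/hirzebruch_spaceX/hirzebruch_monomialE.
by rewrite !mnm0E; split; lia.
Qed.

Lemma hirzebruch_spaceXn a b n f :
  hirzebruch_space e a b f -> hirzebruch_space e (n * a) (n * b) (f ^+ n).
Proof.
move=> hf; elim: n => [|n IHn]; first exact: hirzebruch_space1.
by rewrite exprS !mulSn; apply: hirzebruch_spaceM.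
Qed.

(** * Linear factors that separate two points *)

Definition Tform (k l : F) : {mpoly F[4]} := k *: 'X_iT1 + l *: 'X_iT2.

(** [X1] has degree (1, 0) and [X2] has degree (1, e), so [N ^+ e] with [N] linear in [T] makes the
    two summands homogeneous of the same degree. *)
Definition Xform (k l : F) (N : {mpoly F[4]}) : {mpoly F[4]} :=
  k *: ('X_iX1 * N ^+ e) + l *: 'X_iX2.

Lemma Tform_space k l : hirzebruch_space e 0 1 (Tform k l).
Proof.
by apply: hirzebruch_spaceD; apply/hirzebruch_spaceZ/hirzebruch_spaceX;
  apply/hirzebruch_monomialE; rewrite !mnm1E /=; split; lia.
Qed.

Lemma Xform_space k l N :
  hirzebruch_space e 0 1 N -> hirzebruch_space e 1 e (Xform k l N).
Proof.
move=> hN; apply: hirzebruch_spaceD; apply: hirzebruch_spaceZ; last first.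
  by apply/hirzebruch_spaceX/hirzebruch_monomialE; rewrite !mnm1E /=; split; lia.
have hX1 : hirzebruch_space e 1 0 ('X_iX1 : {mpoly F[4]}).
  by apply/hirzebruch_spaceX/hirzebruch_monomialE; rewrite !mnm1E /=; split; lia.
by have := hirzebruch_spaceM hX1 (hirzebruch_spaceXn e hN); rewrite muln0 muln1.
Qed.

Definition value f P : F := f.@[tnth (coordinates P)].

Lemma valueM f g P : value (f * g) P = value f P * value g P.
Proof. exact: mevalM. Qed.

Lemma valueXn f n P : value (f ^+ n) P = value f P ^+ n.
Proof. exact: rmorphXn. Qed.

Lemma value_Tform k l P :
  value (Tform k l) P = k * repr1 P.2 + l * repr2 P.2.
Proof. by rewrite /value mevalD !mevalZ !mevalXU. Qed.

Lemma value_Xform k l N P :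
  value (Xform k l N) P = k * (repr1 P.1 * value N P ^+ e) + l * repr2 P.1.
Proof. by rewrite /value mevalD !mevalZ mevalM !mevalXU rmorphXn. Qed.

Lemma exists_form_neq0 (x : proj_line F) :
  exists k l : F, k * repr1 x + l * repr2 x != 0.
Proof.
by case: x => [c|]; [exists 1, 0 | exists 0, 1];
  rewrite /= mul0r mul1r ?addr0 ?add0r oner_neq0.
Qed.

Lemma exists_form_separating (x y : proj_line F) : x != y ->
  exists k l : F, k * repr1 x + l * repr2 x != 0 /\ k * repr1 y + l * repr2 y = 0.
Proof.
(* The determinant of the argument with the representative of [y]. *)
move=> nxy; exists (repr2 y), (- repr1 y); split; last by ring.
case: x y nxy => [c|] [d|] //= nxy; rewrite ?mulr1 ?mulr0 ?mulN1r ?mul1r.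
- by rewrite subr_eq0; apply: contraNneq nxy => ->.
- by rewrite oppr0 mul0r addr0 oner_neq0.
- by rewrite add0r oppr_eq0 oner_neq0.
Qed.

(** Every representative has a coordinate equal to 1. With value 1, powers of [N] disappear from
    evaluations over [t]. *)
Lemma exists_Tform_eq1 (t : proj_line F) :
  exists2 N, hirzebruch_space e 0 1 N & forall P, P.2 = t -> value N P = 1.
Proof.
case: t => [c|]; [exists (Tform 1 0) | exists (Tform 0 1)]; try exact: Tform_space;
  by move=> P Pt; rewrite value_Tform Pt /= !(mul0r, mul1r, addr0, add0r).
Qed.

Lemma exists_separating_factor P Q : Q != P ->
  exists2 f, hirzebruch_space e 1 (e + 1) f & value f P != 0 /\ value f Q = 0.
Proof.
move=> nQP; have [N hN N1] := exists_Tform_eq1 P.2.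
have [eqt|neqt] := eqVneq P.2 Q.2.
  have nx : P.1 != Q.1.
    apply: contraNneq nQP => eqx.
    by rewrite (surjective_pairing P) (surjective_pairing Q) eqx eqt.
  have [k [l [hP hQ]]] := exists_form_separating nx.
  (* The extra [N] lifts degree (1, e) to (1, e + 1), the degree reached in the other case. *)
  exists (Xform k l N * N); first exact: hirzebruch_spaceM (Xform_space k l hN) hN.
  by rewrite !valueM !value_Xform !N1 // expr1n !mulr1 hQ.
have [k [l [hP hQ]]] := exists_form_separating neqt.
have [k' [l' hP']] := exists_form_neq0 P.1.
exists (Xform k' l' N * Tform k l).
  exact: hirzebruch_spaceM (Xform_space k' l' hN) (Tform_space k l).
rewrite !valueM !value_Xform !value_Tform hQ mulr0; split=> //.
by rewrite N1 // expr1n mulr1 mulf_neq0.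
Qed.

(** * Separating a point from several others, and the lower bound *)

Lemma exists_value_neq0 a d P :
  exists2 f, hirzebruch_space e a (e * a + d) f & value f P != 0.
Proof.
have [N hN N1] := exists_Tform_eq1 P.2; have [k [l hkl]] := exists_form_neq0 P.1.
exists (Xform k l N ^+ a * N ^+ d).
  have := hirzebruch_spaceM (hirzebruch_spaceXn a (Xform_space k l hN))
    (hirzebruch_spaceXn d hN).
  by rewrite !muln1 muln0 addn0 mulnC.
by rewrite valueM !valueXn value_Xform N1 // !expr1n !mulr1 expf_neq0.
Qed.

(** Induction on [s]: a separating factor has degree (1, e + 1), so each point of [s] costs one unit
    of [a] and one of [d]. *)
Lemma exists_separating a d P (s : seq (hirzebruch_point F)) :
  P \notin s -> (size s <= minn a d)%N ->
  exists2 f, hirzebruch_space e a (e * a + d) f &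
    value f P != 0 /\ {in s, forall Q, value f Q = 0}.
Proof.
elim: s a d => [|Q s IHs] a d.
  by have [f hf fP] := exists_value_neq0 a d P; exists f.
case: a d => [|a] [|d]; rewrite ?minn0 ?min0n // minnSS ltnS inE negb_or eq_sym.
move=> /andP[nQP nPs] /(IHs _ _ nPs)[f hf [fP fs]].
have [g hg [gP gQ]] := exists_separating_factor nQP.
exists (g * f).
  have := hirzebruch_spaceM hg hf.
  by rewrite add1n; congr (hirzebruch_space _ _ _ _); lia.
rewrite valueM mulf_neq0 //; split=> // R; rewrite inE valueM.
by move=> /orP[/eqP->|/fs->]; rewrite ?gQ ?mul0r ?mulr0.
Qed.

Lemma dual_weight_ge a d w :
  dual_code (@hirzebruch_code F e a (e * a + d)) w -> w != 0 ->
  (minn a d + 2 <= hamming_weight w)%N.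
Proof.
move=> hw nw0; rewrite leqNgt; apply/negP; rewrite addn2 ltnS /hamming_weight => wtw.
have [P wP] : exists P, w P != 0.
  by apply/existsP; apply: contraR nw0 => /existsPn w0; apply/eqP/ffunP=> P;
    rewrite ffunE; apply/eqP/negPn/w0.
(* Without [P] the support has at most [minn a d] points; pairing [w] with [f] then leaves only the
   nonzero term at [P]. *)
have [| |f hf [fP fs]] := @exists_separating a d P (enum ([set Q | w Q != 0] :\ P)).
- by rewrite mem_enum !inE eqxx.
- by rewrite -cardE; rewrite (cardsD1 P) inE wP in wtw.
have := hw _ (ex_intro2 _ _ f hf erefl).
rewrite (bigD1 P) //= big1 => [|Q nQP].
  by rewrite addr0 ffunE => /eqP; rewrite mulf_eq0 (negPf wP) orbF (negPf fP).
have [->|wQ] := eqVneq (w Q) 0; first by rewrite mulr0.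
by rewrite ffunE [X in X * _]fs ?mul0r // mem_enum !inE nQP.
Qed.

(** * Dual words supported on a curve, and the upper bound *)

Lemma dual_codeP a b (w : word F (hirzebruch_point F)) :
  (forall m, hirzebruch_monomial e a b m ->
    \sum_P value 'X_[m] P * w P = 0) ->
  dual_code (@hirzebruch_code F e a b) w.
Proof.
move=> hw _ [f /hirzebruch_spaceP hf ->].
have fE P : hirzebruch_eval f P = \sum_(m <- msupp f) f@_m * value 'X_[m] P.
  by rewrite ffunE {1}(mpolyE f) raddf_sum; apply: eq_bigr => m _; exact: mevalZ.
under eq_bigr do rewrite fE mulr_suml.
rewrite exchange_big big_seq big1 //= => m /hf /hw w0.
under eq_bigr do rewrite -mulrA.
by rewrite -mulr_sumr w0 mulr0.
Qed.

Lemma value_monomial m P :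
  value 'X_[m] P = repr1 P.1 ^+ m iX1 * repr2 P.1 ^+ m iX2 *
                   (repr1 P.2 ^+ m iT1 * repr2 P.2 ^+ m iT2).
Proof.
rewrite /value mevalX !big_ord_recl big_ord0 !(tnth_nth 0) mulr1 -!mulrA.
by do !congr (_ * _); congr (_ ^+ m _); apply: val_inj.
Qed.

End HirzebruchSpace.

Lemma exists_extension_by_zero (F : finFieldType) (I J : finType) (p : I -> J)
    (v : I -> F) : injective p ->
  exists w : {ffun J -> F},
    [/\ forall i, w (p i) = v i,
        #|[set j | w j != 0%R]| = #|[set i | v i != 0%R]| &
        forall c : J -> F, \sum_j c j * w j = \sum_i c (p i) * v i].
Proof.
(* By injectivity each fibre sum has at most one term, and it is 0 off the image of [p], so no
   preimage has to be chosen. *)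
move=> p_inj; pose w := [ffun j => \sum_(i | p i == j) v i].
have wp i : w (p i) = v i.
  by rewrite ffunE (eq_bigl (pred1 i)) ?big_pred1_eq // => k; rewrite (inj_eq p_inj).
exists w; split=> [//||c].
- rewrite -(card_imset _ p_inj); apply: eq_card => j; rewrite inE.
  apply/idP/imsetP=> [wj|[i + ->]]; last by rewrite inE wp.
  have [i /eqP pij] : exists i, p i == j.
    apply/existsP; apply: contraR wj => /existsPn np.
    by rewrite ffunE big1 // => i; rewrite (negPf (np i)).
  by exists i; rewrite // inE -wp pij.
under eq_bigr do rewrite ffunE mulr_sumr.
rewrite (exchange_big_dep predT) //=; apply: eq_bigr => i _.
by rewrite (big_pred1 (p i)) // => j; rewrite /= eq_sym.
Qed.

(* The functionals at d + 2 points lie in the (d + 1)-dimensional dual of the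
   space of binary forms of degree d. *)
Lemma exists_form_dependency (F : finFieldType) (d : nat) : (d < #|F|)%N ->
  exists u : {ffun proj_line F -> F},
    [/\ exists t, u t != 0, (#|[set t | u t != 0%R]| <= d.+2)%N &
      forall i j, (i + j = d)%N ->
        \sum_t repr1 t ^+ i * repr2 t ^+ j * u t = 0].
Proof.
(* The projective line has [#|F| + 1] points, hence at least [d + 2]. *)
move=> ltdF; have le_n : (d.+2 <= #|{: proj_line F}|)%N by rewrite card_option.
pose p (k : 'I_d.+2) : proj_line F := enum_val (widen_ord le_n k).
have p_inj : injective p by move=> k l /enum_val_inj /(congr1 val) /= /val_inj.
pose M := \matrix_(k < d.+2, i < d.+1) (repr1 (p k) ^+ i * repr2 (p k) ^+ (d - i)).
(* [M] has one more row than columns, so its left kernel is nonzero. *)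
have [v vM v0] : exists2 v : 'rV_d.+2, v *m M = 0 & v != 0.
  have : kermx M != 0.
    by rewrite kermx_eq0 /row_free neq_ltn ltnS (rank_leq_col M).
  by case/rowV0Pn=> v /sub_kermxP; exists v.
have [u [up cardu sumu]] := exists_extension_by_zero (v 0) p_inj.
exists u; split.
- by have /rV0Pn[k vk] := v0; exists (p k); rewrite up.
- by rewrite cardu; apply: leq_trans (max_card _) _; rewrite card_ord.
move=> i j ijd; have ltid : (i < d.+1)%N by lia.
have /rowP/(_ (Ordinal ltid)) := vM; rewrite sumu !mxE => sum0.
rewrite -[RHS]sum0; apply: eq_bigr => k _.
by rewrite !mxE mulrC (_ : j = d - i)%N //; lia.
Qed.

(** A dependency among binary forms of degree [d], carried along the curve [pt], kills every
    monomial of the space, since each restricts to 0 or to a monomial of degree [d]. *)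
Lemma exists_small_dual_word (F : finFieldType) (e a b d : nat)
    (pt : proj_line F -> hirzebruch_point F) :
  (d < #|F|)%N -> injective pt ->
  (forall m, hirzebruch_monomial e a b m ->
     (forall t, value 'X_[m] (pt t) = 0) \/
     exists i j, (i + j = d)%N /\
       forall t, value 'X_[m] (pt t) = repr1 t ^+ i * repr2 t ^+ j) ->
  exists w, [/\ dual_code (@hirzebruch_code F e a b) w, w != 0 &
    (hamming_weight w <= d.+2)%N].
Proof.
move=> /exists_form_dependency[u [[t ut] wtu hu]] pt_inj hpt.
have [w [wpt cardw sumw]] := exists_extension_by_zero u pt_inj.
exists w; split; last by rewrite /hamming_weight cardw.
- apply: dual_codeP => m hm; rewrite sumw.
  have [z|[i [j [ijd v]]]] := hpt m hm.
    by rewrite big1 // => s _; rewrite z mul0r.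
  by rewrite -[RHS](hu i j ijd); apply: eq_bigr => s _; rewrite v.
- by apply: contraNneq ut => w0; rewrite -wpt w0 ffunE.
Qed.

Lemma exists_dual_word_over_x (F : finFieldType) (e a d : nat) : (d < #|F|)%N ->
  exists w, [/\ dual_code (@hirzebruch_code F e a (e * a + d)) w, w != 0 &
    (hamming_weight w <= d.+2)%N].
Proof.
move=> ltdF; apply: (exists_small_dual_word (pt := pair None)) => //.
  by move=> ? ? [].
move=> m /hirzebruch_monomialE[hX hT].
(* On x = (0 : 1) a positive power of [X1] vanishes, while exponent 0 gives 1 and forces [T]-degree
   [d]. *)
have [m1|m1] := posnP (m iX1); last first.
  by left=> t; rewrite value_monomial /= expr0n gtn_eqF // !mul0r.
right; exists (m iT1), (m iT2); split; first by lia.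
by move=> t; rewrite value_monomial m1 /= expr0 expr1n !mul1r.
Qed.

Lemma exists_dual_word_over_t (F : finFieldType) (e a b : nat) : (a < #|F|)%N ->
  exists w, [/\ dual_code (@hirzebruch_code F e a b) w, w != 0 &
    (hamming_weight w <= a.+2)%N].
Proof.
move=> ltaF; apply: (exists_small_dual_word (pt := pair^~ None)) => //.
  by move=> ? ? [].
move=> m /hirzebruch_monomialE[hX hT].
(* On t = (0 : 1) the [T]-part is 0 or 1, and the [X]-degree is always [a]. *)
have [m1|m1] := posnP (m iT1); last first.
  by left=> t; rewrite value_monomial /= expr0n gtn_eqF // mul0r mulr0.
right; exists (m iX1), (m iX2); split=> // t.
by rewrite value_monomial m1 /= expr0 expr1n !mulr1.
Qed.

Local Close Scope ring_scope.

Theorem theorem2p17 (q : nat) (F : finFieldType) (hq : #|F| = q)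
    (e a b : nat) (ha : 1 <= a <= q - 1)
    (hb : e * a <= b) (hbq : b - e * a <= q - 1) :
  is_min_distance (dual_code (@hirzebruch_code F e a b))
    (minn a (b - e * a) + 2).
Proof.
have [ltaF ltdF] : a < #|F| /\ b - e * a < #|F| by lia.
rewrite -{1}(subnKC hb); set d := b - e * a in ltdF *.
split; last by move=> w; apply: dual_weight_ge.
have [w [hw w0 wtw]] : exists w, [/\ dual_code (@hirzebruch_code F e a (e * a + d)) w,
    w != 0%R & hamming_weight w <= minn a d + 2].
  (* The smaller of [a] and [d] decides which of the two curves carries the word. *)
  rewrite addn2; have [_|_] := leqP a d.
    exact: exists_dual_word_over_t.
  exact: exists_dual_word_over_x.
by exists w; split=> //; apply/eqP; rewrite eqn_leq wtw (dual_weight_ge hw w0).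
Qed.
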